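(* Let $\mathcal{H}\subseteq\mathcal{K}$ be complex Hilbert spaces, let $T\in\mathcal{B}(\mathcal{H})$ be a contraction and let $W\in\mathcal{B}(\mathcal{K})$ be a co-isometric extension of $T$. Let $X\in\mathcal{B}(\mathcal{H})$. Let $Q\in\mathcal{B}(\mathcal{H})$ and $\overline{Q}\in\mathcal{B}(\mathcal{K})$ be contractions such that $\mathcal{H}$ reduces $\overline{Q}$ and $\overline{Q}|_{\mathcal{H}}=Q$. (i) If $XTQ=TX$, then there exists an extension $Y\in\mathcal{B}(\mathcal{K})$ of $X$ such that $YW\overline{Q}=WY$. (ii) If $XQT=TX$, then there exists an extension $Y\in\mathcal{B}(\mathcal{K})$ of $X$ such that $Y\overline{Q}W=WY$. (iii) If moreover $Q$ and $\overline{Q}$ are unitary and $QXT=TX$, then there exists an extension $Y\in\mathcal{B}(\mathcal{K})$ of $X$ such that $\overline{Q}YW=WY$. In all cases $T^nX^m=P_{\mathcal{H}}W^nY^m|_{\mathcal{H}}$ and $X^nT^m=P_{\mathcal{H}}Y^nW^m|_{\mathcal{H}}$ for all integers $n,m\geq 0$, and $Y$ can be chosen such that $\|Y\|=\|X\|$.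
   Context: For Hilbert spaces $\mathcal{H}\subseteq\mathcal{K}$, $S\in\mathcal{B}(\mathcal{K})$ is an extension of $T\in\mathcal{B}(\mathcal{H})$ if $S h=Th$ for all $h\in\mathcal{H}$; a co-isometric extension is an extension $W$ with $WW^*=I$. $P_{\mathcal{H}}$ is the orthogonal projection onto $\mathcal{H}$. *)

(* Defs.v *)
From HB Require Import structures.
From mathcomp Require Import all_boot all_order all_algebra.
From mathcomp Require Export complex.
From mathcomp Require Export classical_sets reals.
Import GRing.Theory Num.Theory.
Set Implicit Arguments. Unset Strict Implicit. Unset Printing Implicit Defensive.
Local Open Scope ring_scope.
Local Open Scope classical_set_scope.

Definition is_inner_product (R : realType) (V : lmodType R[i])
    (ip : V -> V -> R[i]) : Prop :=
  [/\ forall (a : R[i]) (x y z : V), ip (a *: x + y) z = a * ip x z + ip y z,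
      forall x y : V, ip y x = (ip x y)^*%C
    & forall x : V, x != 0 -> 0 < ip x x ].

Definition ipnorm (R : realType) (V : lmodType R[i]) (ip : V -> V -> R[i])
    (x : V) : R := Num.sqrt (complex.Re (ip x x)).

Definition ip_complete (R : realType) (V : lmodType R[i])
    (ip : V -> V -> R[i]) : Prop :=
  forall u : nat -> V,
  (forall e : R, 0 < e -> exists N : nat, forall m n : nat,
      (N <= m)%N -> (N <= n)%N -> ipnorm ip (u m - u n) < e) ->
  exists l : V, forall e : R, 0 < e -> exists N : nat, forall n : nat,
      (N <= n)%N -> ipnorm ip (u n - l) < e.

Definition hilbert (R : realType) (V : lmodType R[i])
    (ip : V -> V -> R[i]) : Prop :=
  is_inner_product ip /\ ip_complete ip.

(* A : V -> V restricted to the (linear) subspace S is an element of B(S):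
   it maps S into S, is linear on S and bounded on S.  Values of A outside
   S are irrelevant.  B(K) is the case S = setT. *)
Definition bounded_op (R : realType) (V : lmodType R[i])
    (ip : V -> V -> R[i]) (S : set V) (A : V -> V) : Prop :=
  [/\ forall x, S x -> S (A x),
      forall (a : R[i]) (x y : V), S x -> S y -> A (a *: x + y) = a *: A x + A y
    & exists c : R, forall x, S x -> ipnorm ip (A x) <= c * ipnorm ip x].

Definition opnorm (R : realType) (V : lmodType R[i])
    (ip : V -> V -> R[i]) (S : set V) (A : V -> V) : R :=
  inf [set c : R | 0 <= c /\ forall x, S x -> ipnorm ip (A x) <= c * ipnorm ip x].

Definition contraction (R : realType) (V : lmodType R[i])
    (ip : V -> V -> R[i]) (S : set V) (A : V -> V) : Prop :=
  opnorm ip S A <= 1.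

Definition orth_proj (R : realType) (V : lmodType R[i])
    (ip : V -> V -> R[i]) (P : V -> V) : Prop :=
  [/\ bounded_op ip setT P, forall x, P (P x) = P x
    & forall x y, ip (P x) y = ip x (P y)].

(* the closed subspace H = range of P (P = P_H) *)
Definition range_of {V : Type} (P : V -> V) : set V := [set x | P x = x].

Definition orth_compl (R : realType) (V : lmodType R[i])
    (ip : V -> V -> R[i]) (S : set V) : set V :=
  [set x | forall h, S h -> ip h x = 0].

Definition extension {V : Type} (H : set V) (S T : V -> V) : Prop :=
  forall h, H h -> S h = T h.

Definition adjoint_on (R : realType) (V : lmodType R[i])
    (ip : V -> V -> R[i]) (S : set V) (A B : V -> V) : Prop :=
  forall x y, S x -> S y -> ip (A x) y = ip x (B y).

Definition coisometric_extension (R : realType) (V : lmodType R[i])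
    (ip : V -> V -> R[i]) (H : set V) (W T : V -> V) : Prop :=
  [/\ bounded_op ip setT W, extension H W T
    & exists Ws, [/\ bounded_op ip setT Ws, adjoint_on ip setT W Ws
                   & forall x, W (Ws x) = x]].

Definition reduces (R : realType) (V : lmodType R[i])
    (ip : V -> V -> R[i]) (H : set V) (A : V -> V) : Prop :=
  (forall x, H x -> H (A x)) /\
  (forall x, orth_compl ip H x -> orth_compl ip H (A x)).

Definition unitary (R : realType) (V : lmodType R[i])
    (ip : V -> V -> R[i]) (S : set V) (A : V -> V) : Prop :=
  exists As, [/\ bounded_op ip S As, adjoint_on ip S A As
               & forall x, S x -> As (A x) = x /\ A (As x) = x].

Definition good_extension (R : realType) (V : lmodType R[i])
    (ip : V -> V -> R[i]) (P T W X : V -> V) (rel : (V -> V) -> Prop) : Prop :=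
  exists Y : V -> V,
    [/\ bounded_op ip setT Y, extension (range_of P) Y X, rel Y,
        (forall (n m : nat) (h : V), range_of P h ->
           iter n T (iter m X h) = P (iter n W (iter m Y h)) /\
           iter n X (iter m T h) = P (iter n Y (iter m W h)))
      & opnorm ip setT Y = opnorm ip (range_of P) X].

(* Main.v *)
From mathcomp Require Import boolp topology normedtype sequences.
From mathcomp Require Import ring lra.
Require Import Defs.
From HB Require Import structures.
From mathcomp Require Import all_boot all_order all_algebra.
From mathcomp Require Import complex classical_sets reals.
Import Order.TTheory GRing.Theory Num.Theory.
Import numFieldNormedType.Exports.
Local Open Scope ring_scope.
Local Open Scope classical_set_scope.
Set Implicit Arguments. Unset Strict Implicit. Unset Printing Implicit Defensive.

(** All three parts are instances of one intertwining problem: given a contraction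
    [A] leaving [H] invariant, a co-isometry [B] and [X A = B X] on [H], extend [X]
    to [Y] on [K] with [Y A = B Y] and the same norm (take [A = W Qb], [B = W] in
    (i); [A = Qb W], [B = W] in (ii); [A = W], [B = Qb^-1 W] in (iii)).

    Start from [Y_0 = X P].  Since [B] is a co-isometry, Parrott's lemma yields
    extensions [Y_n] of [X] with [||Y_n|| <= ||X||] and [B Y_(n+1) = Y_n A], and the
    weak Banach limit [Y] of this sequence satisfies [B Y = Y A].  No dilation space
    is needed.  Only the real part of the inner product is used: it determines the
    norm and separates points, so limits are taken in [R]. *)

(** * Banach limits of bounded real sequences *)

Section BanachLimit.
Variable R : realType.
Implicit Types (u v : nat -> R) (M : R).

Definition seq_bounded u := exists M, forall n, `|u n| <= M.

(** The values lie in a compact segment, so the image of [G] has a cluster point. It is a limit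
    because an ultrafilter contains every set or its complement. *)
Lemma ultra_bounded_cvg (G : set_system nat) u : UltraFilter G ->
  seq_bounded u -> cvg (u @ G).
Proof.
move=> GU [M uM]; have GP : ProperFilter G by exact: ultra_proper.
have GA : G (u @^-1` `[- M, M]).
  apply: (@filterS _ G _ setT _ _ filterT) => n _ /=.
  by rewrite in_itv /= -ler_norml.
have [p [_ clp]] := @segment_compact R (- M) M (u @ G) _ GA.
apply/cvg_ex; exists p => A Ap.
have [//|GnA] := in_ultra_setVsetC (u @^-1` A) GU.
have [x [nAx Ax]] := clp (~` A) A GnA Ap.
by [].
Qed.

Definition cesaro u : nat -> R := fun n => (\sum_(i < n.+1) u i) / n.+1%:R.

Lemma cesaro_bounded u M : (forall n, `|u n| <= M) -> forall n, `|cesaro u n| <= M.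
Proof.
move=> uM n; rewrite /cesaro normrM normfV normr_nat ler_pdivrMr ?ltr0n //.
apply: (le_trans (ler_norm_sum _ _ _)).
have -> : M * n.+1%:R = \sum_(i < n.+1) M by rewrite sumr_const card_ord mulr_natr.
by apply: ler_sum => i _; exact: uM.
Qed.

(** The sums telescope; for bounded [u] the difference tends to 0, whence the shift invariance of
    [banach_limit]. *)
Lemma cesaro_shift u n : cesaro (fun i => u i.+1) n - cesaro u n =
  (u n.+1 - u 0%N) / n.+1%:R.
Proof.
rewrite /cesaro -mulrBl; congr (_ / _).
rewrite big_ord_recr /= [X in _ - X]big_ord_recl /=.
rewrite /bump /=; under [X in _ - (_ + X)]eq_bigr do rewrite add1n.
ring.
Qed.

(** [L] is the limit of the Cesaro means along an ultrafilter finer than the eventually filter: the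
    ultrafilter makes all these means converge, the averaging gives shift invariance. *)
Lemma banach_limit : exists L : (nat -> R) -> R,
  [/\ forall (a : R) u v, seq_bounded u -> seq_bounded v ->
        L (fun n => a * u n + v n) = a * L u + L v,
      forall u, seq_bounded u -> L (fun n => u n.+1) = L u,
      forall c, L (fun=> c) = c
    & forall u M, (forall n, `|u n| <= M) -> `|L u| <= M].
Proof.
have [G [GU Goo]] := ultraFilterLemma (@eventually_filter).
have GP : ProperFilter G by exact: ultra_proper.
have bc u : seq_bounded u -> cvg (cesaro u @ G).
  move=> [M uM]; apply: ultra_bounded_cvg => //.
  by exists M; exact: cesaro_bounded.
exists (fun u => lim (cesaro u @ G)); split.
- move=> a u v bu bv; apply/cvg_lim => //.
  have -> : cesaro (fun n => a * u n + v n) = (fun n => a * cesaro u n + cesaro v n).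
    apply/funext => n; rewrite /cesaro big_split /= -mulr_sumr; ring.
  by apply: cvgD; [apply: cvgMl_tmp|]; exact: bc.
- move=> u bu; apply/cvg_lim => //.
  have -> : cesaro (fun n => u n.+1) =
      (fun n => cesaro u n + (u n.+1 - u 0%N) / n.+1%:R).
    by apply/funext => n; rewrite -cesaro_shift addrC subrK.
  rewrite -[X in _ --> X]addr0; apply: cvgD; first exact: bc.
  (* As [G] refines the eventually filter, ordinary convergence to 0 is enough. *)
  apply: cvg_trans.
    by apply: cvg_app; exact: Goo.
  have [M uM] := bu.
  have M0 : 0 <= M by exact: le_trans (uM 0%N).
  apply/cvgrPdist_lt => e e0.
  (* The numerator is at most [2 * M]; the added 1 keeps the divisor positive when [M] is 0. *)
  have := @cvg_harmonic R; move=> /cvgrPdist_lt /(_ (e / (2 * M + 1))).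
  have M1 : 0 < 2 * M + 1 by lra.
  rewrite divr_gt0 // => /(_ isT); apply: filterS => n /=.
  rewrite !sub0r !normrN !normrM /harmonic.
  set h := `|n.+1%:R^-1| => hn.
  have h0 : 0 <= h by exact: normr_ge0.
  have Hu : `|u n.+1 - u 0%N| <= 2 * M.
    by apply: (le_trans (ler_normB _ _)); have := uM n.+1; have := uM 0%N; lra.
  apply: (@le_lt_trans _ _ ((2 * M + 1) * h)); last by rewrite mulrC -ltr_pdivlMr.
  by apply: ler_wpM2r => //; lra.
- move=> c; apply/cvg_lim => //.
  have -> : cesaro (fun=> c) = (fun=> c).
    apply/funext => n; rewrite /cesaro sumr_const card_ord -[c *+ _]mulr_natr mulfK //.
    by rewrite pnatr_eq0.
  exact: cvg_cst.
- move=> u M uM.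
  have cu : cesaro u @ G --> lim (cesaro u @ G) by apply: bc; exists M.
  rewrite ler_norml; apply/andP; split.
    apply: (limr_ge cu); apply: (filterS _ (@filterT _ G _)) => n _.
    by have := cesaro_bounded uM n; rewrite ler_norml => /andP[].
  apply: (limr_le cu); apply: (filterS _ (@filterT _ G _)) => n _.
  by have := cesaro_bounded uM n; rewrite ler_norml => /andP[].
Qed.

End BanachLimit.

(** * Positive semidefinite forms and approximate Riesz representation *)

Section SemiForm.
Variables (R : realType) (V : lmodType R[i]).
Implicit Types (s : V -> V -> R) (N : set V) (x y z : V).

(** This models the real part of a positive semidefinite Hermitian form; the fourth clause carries
    the complex structure. Degenerate forms are allowed, since the form [q] of [parrott_extension]
    may vanish on nonzero vectors. *)
Definition semiform s := [/\
  forall x y z, s (x + y) z = s x z + s y z,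
  forall x y, s x y = s y x,
  forall (t : R) x y, s (t%:C%C *: x) y = t * s x y,
  forall (a : R[i]) x y, s (a *: x) y = s x (a^*%C *: y)
  & forall x, 0 <= s x x].

Definition snorm s x : R := Num.sqrt (s x x).

Definition subspace N :=
  N 0 /\ forall (a : R[i]) x y, N x -> N y -> N (a *: x + y).

Definition linear_on N (A : V -> V) :=
  forall (a : R[i]) x y, N x -> N y -> A (a *: x + y) = a *: A x + A y.

Definition real_linear_on N (f : V -> R) :=
  forall (t : R) x y, N x -> N y -> f (t%:C%C *: x + y) = t * f x + f y.

Definition cabs (a : R[i]) : R :=
  Num.sqrt (complex.Re a ^+ 2 + complex.Im a ^+ 2).

Lemma cabs_ge0 a : 0 <= cabs a.
Proof. exact: sqrtr_ge0. Qed.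

Lemma quadratic_ge0_discr (a b c : R) : 0 <= a ->
  (forall t, 0 <= t ^+ 2 * a + 2 * t * b + c) -> b ^+ 2 <= a * c.
Proof.
move=> a0 q; have [aE|an0] := eqVneq a 0.
  have [->|bn0] := eqVneq b 0; first by rewrite aE mul0r expr0n.
  (* With [a = 0] the polynomial is affine in t and takes the value -1 here. *)
  have := q (- (c + 1) / (2 * b)).
  rewrite aE (_ : _ + c = -1); first by rewrite oppr_ge0 ler10.
  by field.
have {}a0 : 0 < a by rewrite lt_def an0.
have := q (- b / a).
rewrite (_ : _ + c = (a * c - b ^+ 2) / a); last by field.
by rewrite pmulr_lge0 ?invr_gt0 // subr_ge0.
Qed.

Lemma subspaceB N x y : subspace N -> N x -> N y -> N (x - y).
Proof. by move=> [N0 Nl] Nx Ny; rewrite addrC -scaleN1r; exact: Nl. Qed.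

Lemma linear_onB N A x y : linear_on N A -> N x -> N y -> A (x - y) = A x - A y.
Proof. by move=> lA Nx Ny; rewrite addrC -scaleN1r lA // scaleN1r addrC. Qed.

Section Theory.
Variable s : V -> V -> R.
Hypothesis sF : semiform s.

Let sDl x y z : s (x + y) z = s x z + s y z. Proof. by case: sF. Qed.
Let sC x y : s x y = s y x. Proof. by case: sF. Qed.
Let sZl t x y : s (t%:C%C *: x) y = t * s x y. Proof. by case: sF. Qed.
Let sJ a x y : s (a *: x) y = s x (a^*%C *: y). Proof. by case: sF. Qed.
Let s_ge0 x : 0 <= s x x. Proof. by case: sF. Qed.

Lemma semiformDr x y z : s z (x + y) = s z x + s z y.
Proof. by rewrite sC sDl ![s _ z]sC. Qed.

Lemma semiformZr t x y : s x (t%:C%C *: y) = t * s x y.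
Proof. by rewrite sC sZl sC. Qed.

Lemma semiformNl x y : s (- x) y = - s x y.
Proof. by rewrite -scaleN1r -(rmorph1 (real_complex R)) -rmorphN sZl mulN1r. Qed.

Lemma semiformBl x y z : s (x - y) z = s x z - s y z.
Proof. by rewrite sDl semiformNl. Qed.

Lemma semiformBr x y z : s z (x - y) = s z x - s z y.
Proof. by rewrite sC semiformBl ![s _ z]sC. Qed.

Lemma semiform_real_linear x N : real_linear_on N (s x).
Proof. by move=> t y z _ _; rewrite semiformDr semiformZr. Qed.

Lemma snorm_ge0 x : 0 <= snorm s x.
Proof. exact: sqrtr_ge0. Qed.

Lemma sqr_snorm x : snorm s x ^+ 2 = s x x.
Proof. exact: sqr_sqrtr. Qed.

Lemma semiform_sqrD x y : s (x + y) (x + y) = s x x + 2 * s x y + s y y.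
Proof. rewrite sDl !semiformDr [s y x]sC; ring. Qed.

Lemma semiform_cauchy_schwarz x y : `|s x y| <= snorm s x * snorm s y.
Proof.
rewrite -ler_sqr ?nnegrE ?mulr_ge0 ?snorm_ge0 // real_normK ?num_real //.
rewrite exprMn !sqr_snorm mulrC; apply: quadratic_ge0_discr => // t.
have := s_ge0 (t%:C%C *: y + x).
rewrite semiform_sqrD !sZl semiformZr [s y x]sC => h.
by apply: (le_trans h); rewrite le_eqVlt; apply/orP; left; apply/eqP; ring.
Qed.

Lemma snormD x y : snorm s (x + y) <= snorm s x + snorm s y.
Proof.
rewrite -ler_sqr ?nnegrE ?addr_ge0 ?snorm_ge0 // sqrrD !sqr_snorm semiform_sqrD.
have := semiform_cauchy_schwarz x y; have := ler_norm (s x y).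
set p := snorm s x * _; rewrite mulr2n => h1 h2; lra.
Qed.

Lemma snormN x : snorm s (- x) = snorm s x.
Proof. by rewrite /snorm semiformNl sC semiformNl opprK. Qed.

Lemma snormZ a x : snorm s (a *: x) = cabs a * snorm s x.
Proof.
rewrite /snorm sJ scalerA.
have -> : a^*%C * a = (complex.Re a ^+ 2 + complex.Im a ^+ 2)%:C%C.
  case: a => p q; apply/eqP; rewrite eq_complex /=.
  by apply/andP; split; apply/eqP; ring.
by rewrite semiformZr sqrtrM // addr_ge0 // sqr_ge0.
Qed.

Lemma cabsJ a : cabs a^*%C = cabs a.
Proof. by case: a => p q; rewrite /cabs /= sqrrN. Qed.

(* Any [h] that minimizes [s h h - 2 f h] over [N] up to [e ^+ 2] works. *)
Lemma approx_riesz N (f : V -> R) (M : R) : subspace N -> real_linear_on N f ->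
  (forall k, N k -> `|f k| <= M * snorm s k) ->
  forall e, 0 < e -> exists2 h, N h &
    forall k, N k -> `|f k - s h k| <= e * snorm s k.
Proof.
move=> [N0 Nl] lf fM e e0.
pose J h := s h h - 2 * f h.
(* Completing the square: n^2 - 2 M n >= - M^2. *)
have lbJ : lbound [set J h | h in N] (- M ^+ 2).
  move=> _ [h Nh <-]; rewrite /J -sqr_snorm.
  have := fM _ Nh; have := ler_norm (f h); set n := snorm s h.
  have := sqr_ge0 (n - M); rewrite sqrrB mulr2n => h1 h2 h3.
  move: h1 h3; rewrite [M * n]mulrC; set p := n * M; lra.
have hJ : has_inf [set J h | h in N].
  by split; [exists (J 0), 0 | exists (- M ^+ 2)].
have [_ [h Nh <-] Jh] := @inf_adherent R _ (e ^+ 2) (exprn_gt0 2 e0) hJ.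
exists h => // k Nk.
rewrite -ler_sqr ?nnegrE ?mulr_ge0 ?snorm_ge0 ?(ltW e0) //.
rewrite real_normK ?num_real // exprMn sqr_snorm mulrC -sqrrN opprB.
(* Near-minimality of [h] along the line h + t k says that t^2 s(k,k) + 2 t (s(h,k) - f(k)) + e^2 is
   nonnegative for all t; the discriminant bound is the claim. *)
apply: quadratic_ge0_discr => // t.
have Nx : N (t%:C%C *: k + h) by exact: Nl.
have : inf [set J h | h in N] <= J (t%:C%C *: k + h).
  by apply: ge_inf; [case: hJ|exists (t%:C%C *: k + h)].
move=> /(lt_le_trans _); move: Jh; rewrite -ltrBlDr => Jh /(_ _ Jh).
rewrite /J semiform_sqrD !sZl semiformZr [s k h]sC lf // => /ltW h1.
rewrite -subr_ge0 in h1.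
by apply: (le_trans h1); rewrite le_eqVlt; apply/orP; left; apply/eqP; ring.
Qed.

Lemma approx_snorm N x e : N x -> 0 <= e ->
  (forall k, N k -> `|s x k| <= e * snorm s k) -> snorm s x <= e.
Proof.
move=> Nx e0 /(_ _ Nx); rewrite -sqr_snorm.
have [-> //|n0] := eqVneq (snorm s x) 0.
have {}n0 : 0 < snorm s x by rewrite lt_def n0 snorm_ge0.
by rewrite ger0_norm ?sqr_ge0 // expr2 ler_pM2r.
Qed.

(** This replaces the uniqueness of the Riesz representative: the difference lies in [N] and can be
    tested against itself. *)
Lemma approx_close N (f : V -> R) h h' e e' : subspace N -> N h -> N h' ->
  0 <= e -> 0 <= e' ->
  (forall k, N k -> `|f k - s h k| <= e * snorm s k) ->
  (forall k, N k -> `|f k - s h' k| <= e' * snorm s k) ->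
  snorm s (h - h') <= e + e'.
Proof.
move=> sN Nh Nh' e0 e0' a a'; apply: (@approx_snorm N).
- exact: subspaceB.
- exact: addr_ge0.
- move=> k Nk; rewrite semiformBl mulrDl.
  have -> : s h k - s h' k = (f k - s h' k) - (f k - s h k) by ring.
  rewrite [leRHS]addrC; apply: (le_trans (ler_normB _ _)).
  by apply: lerD; [exact: a'|exact: a].
Qed.

End Theory.
End SemiForm.

(** * The real inner product of a Hilbert space *)

Section Hilbert.
Variables (R : realType) (V : lmodType R[i]) (ip : V -> V -> R[i]).
Hypothesis hV : hilbert ip.

Definition reip (x y : V) : R := complex.Re (ip x y).

Lemma ipnormE x : ipnorm ip x = snorm reip x.
Proof. by []. Qed.

Lemma reip_semiform : semiform reip.
Proof.
have [[lin herm pos] _] := hV.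
have ip0 z : ip 0 z = 0.
  by have := lin (-1) 0 0 z; rewrite scaler0 addr0 mulN1r addNr.
have ipZ a x z : ip (a *: x) z = a * ip x z.
  by rewrite -[a *: x]addr0 lin ip0 addr0.
have ipD x y z : ip (x + y) z = ip x z + ip y z.
  by rewrite -[x in ip (x + y)]scale1r lin mul1r.
split=> [x y z|x y|t x y|a x y|x]; rewrite /reip.
- by rewrite ipD; case: (ip x z); case: (ip y z).
- by rewrite herm; case: (ip y x).
- by rewrite ipZ; case: (ip x y) => p q /=; ring.
- rewrite [ip x _]herm !ipZ [ip y x]herm.
  by case: (ip x y) => p q; case: a => a b /=; ring.
- have [->|/pos] := eqVneq x 0; first by rewrite ip0.
  by rewrite ltcE /= => /andP[_ /ltW].
Qed.

Let rF := reip_semiform.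

Lemma ipnorm_eq0 x : ipnorm ip x = 0 -> x = 0.
Proof.
have [//|xn0] := eqVneq x 0.
have [[_ _ /(_ _ xn0) pos] _] := hV.
move: pos; rewrite ltcE /= => /andP[_ h].
by move=> /eqP; rewrite gt_eqF // sqrtr_gt0.
Qed.

Lemma ipnorm_small x (c : R) : (forall e, 0 < e -> ipnorm ip x <= c * e) -> x = 0.
Proof.
move=> h; apply: ipnorm_eq0; apply/eqP; rewrite eq_le (snorm_ge0 reip) andbT.
have [c0|c0] := leP c 0.
  by apply: le_trans (h 1 ltr01) _; rewrite mulr1.
apply/ler_addgt0Pr => e e0; rewrite add0r.
have := h (e / c); rewrite divr_gt0 // => /(_ isT).
by rewrite mulrC divfK ?gt_eqF.
Qed.

Lemma reip_ext x y : (forall z, reip x z = reip y z) -> x = y.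
Proof.
move=> h; apply/eqP; rewrite -subr_eq0; apply/eqP/ipnorm_eq0.
by rewrite ipnormE /snorm (semiformBl rF) h subrr sqrtr0.
Qed.

(** * Extension of operators dominated by a semidefinite form *)

Section Approx.
Variables (s : V -> V -> R) (N : set V) (D0 : V -> V).
Hypotheses (sF : semiform s) (sN : subspace N) (lD0 : linear_on N D0).
Hypothesis D0s : forall k, N k -> ipnorm ip (D0 k) <= snorm s k.

(** [N] need not be complete for [s], so [f] may have no representative in [N]. Approximate ones are
    Cauchy for [s], hence their images under [D0] converge in the Hilbert space; quantifying over
    all [h] and [e] makes the limit independent of the sequence chosen. *)
Lemma approx_limit (f : V -> R) (M : R) : real_linear_on N f ->
  (forall k, N k -> `|f k| <= M * snorm s k) ->
  exists v, forall h e, N h -> 0 <= e ->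
    (forall k, N k -> `|f k - s h k| <= e * snorm s k) ->
    ipnorm ip (D0 h - v) <= e.
Proof.
move=> lf fM.
have i0 n : 0 < n.+1%:R^-1 :> R by rewrite invr_gt0 ltr0n.
have /choice[h hP] : forall n : nat, exists h, N h /\
    forall k, N k -> `|f k - s h k| <= n.+1%:R^-1 * snorm s k.
  by move=> n; have [h] := approx_riesz sF sN lf fM (i0 n); exists h.
have near (g : V) (e : R) : N g -> 0 <= e ->
    (forall k, N k -> `|f k - s g k| <= e * snorm s k) ->
    forall n, ipnorm ip (D0 g - D0 (h n)) <= e + n.+1%:R^-1.
  move=> Ng e0 ga n; have [Nh ha] := hP n.
  rewrite -(linear_onB lD0) //; apply: le_trans.
    by apply: D0s; exact: subspaceB.
  by apply: (approx_close sF sN _ _ _ _ ga ha) => //; exact: ltW.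
have small (e : R) : 0 < e -> exists n0, forall n, (n0 <= n)%N -> n.+1%:R^-1 < e.
  move=> e0; exists (Num.Def.archi_bound e^-1) => n ln.
  rewrite -[e]invrK ltf_pV2 ?posrE ?ltr0n ?invr_gt0 //.
  apply: (lt_le_trans (archi_boundP _)); first by rewrite invr_ge0 ltW.
  by rewrite ler_nat (leq_trans ln).
have [_ complete] := hV.
have [|v hv] := complete (D0 \o h).
  move=> e e0; have [n0 n0P] := small (e / 2) (divr_gt0 e0 (ltr0Sn _ 1)).
  exists n0 => m n lm ln /=; have [Nm hm] := hP m.
  apply: (le_lt_trans (near _ _ Nm (ltW (i0 m)) hm n)).
  by rewrite [e]splitr ltrD // n0P.
exists v => g e Ng e0 ga; apply/ler_addgt0Pr => d d0.
have [n1 n1P] := small (d / 2) (divr_gt0 d0 (ltr0Sn _ 1)).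
have [n2 n2P] := hv (d / 2) (divr_gt0 d0 (ltr0Sn _ 1)).
pose n := maxn n1 n2.
rewrite -[D0 g](subrK (D0 (h n))) -addrA.
apply: (le_trans (snormD rF _ _)).
have := near _ _ Ng e0 ga n; have := n1P n (leq_maxl _ _).
have := n2P n (leq_maxr _ _); rewrite /= !ipnormE; move: (n.+1%:R^-1) => i; lra.
Qed.

(** Morally [D] is [D0] composed with the [s]-orthogonal projection onto the completion of [N];
    [approx_limit] applied to the functional [s x] avoids constructing that completion. *)
Lemma extend_dominated : exists D : V -> V,
  [/\ linear_on setT D, forall h, N h -> D h = D0 h
    & forall x, ipnorm ip (D x) <= snorm s x].
Proof.
have sb x k : N k -> `|s x k| <= snorm s x * snorm s k.
  by move=> _; exact: semiform_cauchy_schwarz.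
have sl x : real_linear_on N (s x) by exact: semiform_real_linear.
have /choice[D DP] x := approx_limit (sl x) (sb x).
have ap x := approx_riesz sF sN (sl x) (sb x).
exists D; split.
- move=> a x y _ _; apply/eqP; rewrite -subr_eq0; apply/eqP.
  (* Approximating [x] and [y] within [e] costs [cabs a * e + e] twice: once for their combination,
     once for the combination of the two limits. *)
  apply: (@ipnorm_small _ (2 * cabs a + 2)) => e e0.
  have [h Nh hP] := ap x _ e0; have [g Ng gP] := ap y _ e0.
  have Nag : N (a *: h + g) by case: sN => _; apply.
  have e1 : 0 <= cabs a * e + e by rewrite addr_ge0 ?mulr_ge0 ?cabs_ge0 // ltW.
  have K : forall k, N k ->
      `|s (a *: x + y) k - s (a *: h + g) k| <= (cabs a * e + e) * snorm s k.
    move=> k Nk; have [sD _ _ sJ _] := sF.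
    rewrite !sD !sJ.
    have Nak : N (a^*%C *: k) by case: sN => N0 Nl; rewrite -[_ *: k]addr0; exact: Nl.
    have := hP _ Nak; have := gP _ Nk; rewrite (snormZ sF) cabsJ.
    set p := s x _; set q := s h _; set p' := s y _; set q' := s g _.
    move=> h1 h2; rewrite (_ : _ - _ = (p - q) + (p' - q')); last by ring.
    apply: (le_trans (ler_normD _ _)).
    rewrite (_ : (_ + e) * _ = e * (cabs a * snorm s k) + e * snorm s k); last by ring.
    exact: lerD.
  have := DP (a *: x + y) _ _ Nag e1 K; rewrite lD0 //.
  have := DP x _ _ Nh (ltW e0) hP; have := DP y _ _ Ng (ltW e0) gP.
  set u := D0 h - D x; set w := D0 g - D y; set z := _ - D (a *: x + y).
  rewrite !ipnormE => hw hu hz.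
  have -> : D (a *: x + y) - (a *: D x + D y) = - z + (a *: u + w).
    by rewrite /z /u /w scalerBr addrACA -opprD addrA opprB subrK.
  apply: (le_trans (snormD rF _ _)); rewrite (snormN rF).
  have := snormD rF (a *: u) w; rewrite (snormZ rF).
  have := ler_wpM2l (cabs_ge0 a) hu.
  lra.
(* An element of [N] represents its own functional with tolerance 0. *)
- move=> h Nh; apply/eqP; rewrite eq_sym -subr_eq0; apply/eqP/ipnorm_eq0.
  apply/eqP; rewrite eq_le (snorm_ge0 reip) andbT; apply: DP => // k Nk.
  by rewrite subrr normr0 mul0r.
- move=> x; apply/ler_addgt0Pr => e e0.
  have e2 : 0 < e / 2 by rewrite divr_gt0.
  have [h Nh hP] := ap x _ e2; have := DP x _ _ Nh (ltW e2) hP.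
  have : snorm s h <= snorm s x + e / 2.
    apply: (approx_snorm sF Nh); first by rewrite addr_ge0 ?snorm_ge0 // ltW.
    move=> k Nk; rewrite (_ : s h k = s x k - (s x k - s h k)); last by ring.
    apply: (le_trans (ler_normB _ _)); rewrite mulrDl; apply: lerD; last exact: hP.
    exact: sb.
  have := D0s Nh; rewrite !ipnormE => h1 h2.
  have := snormD rF (D0 h) (- (D0 h - D x)).
  rewrite (snormN rF) opprB addrCA subrr addr0; lra.
Qed.

End Approx.
End Hilbert.

(** * Riesz representation and weak Banach limits of operators *)

Section Lifting.
Variables (R : realType) (V : lmodType R[i]) (ip : V -> V -> R[i]).
Hypothesis hV : hilbert ip.
Local Notation r := (reip ip).
Local Notation rF := (reip_semiform hV).
Local Notation "`n x" := (ipnorm ip x) (at level 10, x at level 8).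

Let n_ge0 x : 0 <= `n x. Proof. exact: (snorm_ge0 r). Qed.
Let n_sqr x : `n x ^+ 2 = r x x. Proof. exact: (sqr_snorm rF). Qed.
Let rC x y : r x y = r y x. Proof. by have [] := rF. Qed.
Let rD x y z : r (x + y) z = r x z + r y z. Proof. by have [] := rF. Qed.
Let rJ a x y : r (a *: x) y = r x (a^*%C *: y). Proof. by have [] := rF. Qed.
Let subT : subspace [set: V]. Proof. by []. Qed.

Lemma ipnorm_sqr_le x (c : R) : 0 <= c -> r x x <= c * `n x -> `n x <= c.
Proof.
move=> c0; rewrite -n_sqr; have [->//|n0] := eqVneq (`n x) 0.
by rewrite expr2 ler_pM2r // lt_def n0 n_ge0.
Qed.

(** The case [D0 = id], [s = r] of [approx_limit]: the limit of approximate representatives is an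
    exact one. *)
Lemma riesz_representation (f : V -> R) (M : R) : real_linear_on setT f ->
  (forall y, `|f y| <= M * `n y) -> exists v, forall y, f y = r v y.
Proof.
move=> lf fM.
have fM' y : setT y -> `|f y| <= M * snorm r y by move=> _; exact: fM.
have [v vP] := @approx_limit _ _ _ hV r setT id rF subT (fun _ _ _ _ _ => erefl)
  (fun _ _ => lexx _) f M lf fM'.
exists v => y; apply/eqP; rewrite -subr_eq0 -normr_le0.
apply/ler_addgt0Pr => e e0; rewrite add0r.
(* Two errors of at most d ||y|| must fit into e = 2 d ||y|| + d. *)
pose d := e / (2 * `n y + 1).
have y1 : 0 < 2 * `n y + 1 by have := n_ge0 y; lra.
have d0 : 0 < d by rewrite divr_gt0.
have [h _ hP] := approx_riesz rF subT lf fM' d0.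
have h1 := vP h d I (ltW d0) hP; have h2 := hP y I.
rewrite (_ : f y - r v y = (f y - r h y) + r (h - v) y); last first.
  by rewrite (semiformBl rF); ring.
apply: (le_trans (ler_normD _ _)).
have h3 := semiform_cauchy_schwarz rF (h - v) y.
have h4 := ler_wpM2r (n_ge0 y) h1.
rewrite [e](_ : e = 2 * (d * `n y) + d); last by rewrite /d; field; rewrite gt_eqF.
by move: h2 h3 h4; rewrite !ipnormE => h2 h3 h4; lra.
Qed.

(** For fixed x, the functional y |-> L(<Y_n x, y>) is bounded by c ||x||, and [Z x] is its Riesz
    representative. Complex linearity follows by moving the scalar into the second argument. *)
Lemma operator_banach_limit (Y : nat -> V -> V) (c : R) (L : (nat -> R) -> R) :
  0 <= c -> (forall n, linear_on setT (Y n)) ->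
  (forall n x, `n (Y n x) <= c * `n x) ->
  (forall (a : R) u v, seq_bounded u -> seq_bounded v ->
     L (fun n => a * u n + v n) = a * L u + L v) ->
  (forall u M, (forall n, `|u n| <= M) -> `|L u| <= M) ->
  exists Z : V -> V, [/\ linear_on setT Z, forall x, `n (Z x) <= c * `n x
    & forall x y, r (Z x) y = L (fun n => r (Y n x) y)].
Proof.
move=> c0 lY bY Llin Lbd.
have bd x y n : `|r (Y n x) y| <= c * `n x * `n y.
  apply: (le_trans (semiform_cauchy_schwarz rF _ _)).
  by apply: ler_wpM2r; [exact: n_ge0|exact: bY].
have sb x y : seq_bounded (fun n => r (Y n x) y) by exists (c * `n x * `n y).
have /choice[Z ZP] : forall x, exists z, forall y, L (fun n => r (Y n x) y) = r z y.
  move=> x; apply: (@riesz_representation _ (c * `n x)) => [t y z _ _|y].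
    rewrite -Llin //; congr L; apply/funext => n.
    by rewrite (semiformDr rF) (semiformZr rF).
  by apply: Lbd => n; exact: bd.
exists Z; split => [a x y _ _|x|x y] //.
- apply: (reip_ext hV) => z; rewrite -ZP rD rJ -!ZP -[X in _ = X + _]mul1r -Llin //.
  by congr L; apply/funext => n; rewrite lY // rD rJ mul1r.
- apply: ipnorm_sqr_le; first exact: mulr_ge0.
  by rewrite -ZP; apply: (le_trans (ler_norm _)); apply: Lbd => n; exact: bd.
Qed.

(** * Parrott's lemma and intertwining extensions *)

Section Coisometry.
Variables (N : set V) (X B Bs : V -> V) (c : R).
Hypotheses (sN : subspace N) (c0 : 0 <= c).
Hypotheses (lX : linear_on N X) (X_le : forall h, N h -> `n (X h) <= c * `n h).
Hypotheses (lB : linear_on setT B) (lBs : linear_on setT Bs).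
Hypothesis B_adj : forall x y, r (B x) y = r x (Bs y).
Hypothesis BBs : forall x, B (Bs x) = x.

(* Parrott's lemma: the missing component of [Y] along [ker B] is an extension
   of the one of [X] that is dominated by the form c^2 <x, y> - <G x, G y>. *)
Lemma parrott_extension (G : V -> V) : linear_on setT G ->
  (forall x, `n (G x) <= c * `n x) -> (forall h, N h -> G h = B (X h)) ->
  exists Y : V -> V, [/\ linear_on setT Y, forall h, N h -> Y h = X h,
    forall x, B (Y x) = G x & forall x, `n (Y x) <= c * `n x].
Proof.
move=> lG G_le GX.
(* The orthogonal projection onto ker B, because [Bs] is isometric. *)
pose F v := v - Bs (B v).
have lF : linear_on setT F.
  move=> a x y _ _; rewrite /F lB // lBs // opprD addrACA; congr (_ + _).
  by rewrite scalerBr.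
have BF v : B (F v) = 0 by rewrite /F (linear_onB lB) // BBs subrr.
have FF v : F (F v) = F v.
  have Bs0 : Bs 0 = 0 by have := linear_onB lBs (x := 0) (y := 0) I I; rewrite !subrr.
  by rewrite {1}/F BF Bs0 subr0.
have rBs u v : r (Bs u) (Bs v) = r u v by rewrite -B_adj BBs.
have F_sqr v : r (F v) (F v) = r v v - r (B v) (B v).
  rewrite /F (semiformBl rF) !(semiformBr rF) rBs [r (Bs _) v]rC -B_adj; ring.
pose q x y := c ^+ 2 * r x y - r (G x) (G y).
have sq x y : `n x <= c * `n y -> r x x <= c ^+ 2 * r y y.
  by move=> h; rewrite -!n_sqr -exprMn ler_sqr ?nnegrE ?mulr_ge0.
have lG0 : G 0 = 0 by have := linear_onB lG (x := 0) (y := 0) I I; rewrite !subrr.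
have GZ a x : G (a *: x) = a *: G x.
  by rewrite -[a *: x]addr0 lG // lG0 addr0.
have GD x y : G (x + y) = G x + G y by rewrite -[x in LHS]scale1r lG // scale1r.
have qF : semiform q.
  have [_ _ rZ _ _] := rF.
  split=> [x y z|x y|t x y|a x y|x]; rewrite /q.
  - rewrite GD !rD; ring.
  - by rewrite rC [r (G x) _]rC.
  - rewrite GZ !rZ; ring.
  - by rewrite !GZ !rJ.
  - by rewrite subr_ge0; exact/sq/G_le.
have lFX : linear_on N (F \o X).
  by move=> a x y Nx Ny /=; rewrite lX // lF.
(* By Pythagoras ||F X k||^2 = ||X k||^2 - ||B X k||^2, and B X k = G k. *)
have FX_le k : N k -> `n (F (X k)) <= snorm q k.
  move=> Nk; rewrite ipnormE /snorm ler_wsqrtr // F_sqr /q GX //.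
  by rewrite lerB // sq // X_le.
have [D [lD DX D_le]] := extend_dominated hV qF sN lFX FX_le.
have FD x : r (F (D x)) (F (D x)) <= q x x.
  rewrite F_sqr; apply: (@le_trans _ _ (r (D x) (D x))).
    by rewrite gerBl -n_sqr sqr_ge0.
  by rewrite -n_sqr -(sqr_snorm qF) ler_sqr ?nnegrE // snorm_ge0.
(* The summands lie in ran B* and ker B, so their squared norms add up to at most ||G x||^2 + q(x,x)
   = c^2 ||x||^2. [F] is reapplied because [D] need not take values in ker B. *)
exists (fun x => Bs (G x) + F (D x)); split.
- move=> a x y _ _; rewrite lG // lBs // lD // lF //.
  by rewrite addrACA -scalerDr.
- by move=> h Nh; rewrite DX //= FF GX // addrC subrK.
- by move=> x; rewrite -[Bs _]scale1r lB // BBs BF scale1r addr0.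
- move=> x; rewrite -ler_sqr ?nnegrE ?mulr_ge0 // n_sqr exprMn n_sqr.
  rewrite (semiform_sqrD rF) rBs -[r (Bs _) (F _)]rC -B_adj BF.
  have -> : r 0 (G x) = 0 by rewrite -(subrr 0) (semiformBl rF) subrr.
  have := FD x; rewrite /q; lra.
Qed.

(* Every [Y] extending [X] admits by Parrott's lemma some [Y'] extending [X] with
   [B Y' = Y A]; shift invariance of a Banach limit then removes the prime. *)
Lemma intertwining_extension (A P : V -> V) :
  linear_on setT P -> (forall x, N (P x)) -> (forall h, N h -> P h = h) ->
  (forall x, `n (P x) <= `n x) ->
  linear_on setT A -> (forall h, N h -> N (A h)) -> (forall x, `n (A x) <= `n x) ->
  (forall h, N h -> X (A h) = B (X h)) ->
  exists Y : V -> V, [/\ linear_on setT Y, forall h, N h -> Y h = X h,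
    forall x, Y (A x) = B (Y x) & forall x, `n (Y x) <= c * `n x].
Proof.
move=> lP NP P_id P_le lA NA A_le XA.
(* Bundling these properties in a sigma type lets choice turn [step] into a map that can be
   iterated. *)
pose good (Y : V -> V) := [/\ linear_on setT Y, forall h, N h -> Y h = X h
  & forall x, `n (Y x) <= c * `n x].
have step (Y : {Y | good Y}) : exists Y' : {Y | good Y},
    forall x, B (sval Y' x) = sval Y (A x).
  case: Y => Y [lY YX Y_le] /=.
  have [|x|h Nh|Y' [lY' YX' BY' Y_le']] := @parrott_extension (Y \o A).
  - by move=> a x y _ _ /=; rewrite lA // lY.
  - by apply: (le_trans (Y_le _)); apply: ler_wpM2l.
  - by rewrite /= YX ?XA //; exact: NA.
  - by have gY : good Y' by []; exists (exist _ Y' gY).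
have good0 : good (X \o P).
  split=> [a x y _ _|h Nh|x] /=.
  - by rewrite lP // lX.
  - by rewrite P_id.
  - by apply: (le_trans (X_le (NP x))); apply: ler_wpM2l.
have [next nextP] := choice step.
pose Y n := sval (iter n next (exist _ _ good0)).
have gY n : good (Y n) by rewrite /Y; case: (iter _ _ _).
have BY n x : B (Y n.+1 x) = Y n (A x) by exact: nextP.
have [L [Llin Lshift Lcst Lbd]] := banach_limit R.
have [n|n x|Z [lZ Z_le ZP]] := @operator_banach_limit Y c L c0 _ _ Llin Lbd.
- by case: (gY n).
- by case: (gY n).
exists Z; split => // [h Nh|x]; apply: (reip_ext hV) => y.
  rewrite ZP -[RHS]Lcst; congr L; apply/funext => n.
  by have [_ -> //] := gY n.
(* After the shift, <Y_(n+1) x, B* y> = <B Y_(n+1) x, y> = <Y_n A x, y>. *)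
rewrite B_adj !ZP -[RHS]Lshift; last first.
  exists (c * `n x * `n (Bs y)) => n.
  apply: (le_trans (semiform_cauchy_schwarz rF _ _)).
  apply: ler_wpM2r; first exact: snorm_ge0.
  by have [_ _ b] := gY n; exact: b.
by congr L; apply/funext => n; rewrite -BY B_adj.
Qed.

End Coisometry.

(** * Operator norms and the passage to [good_extension] *)

Lemma opnorm_attained (S : set V) (A : V -> V) : bounded_op ip S A ->
  0 <= opnorm ip S A /\ forall x, S x -> `n (A x) <= opnorm ip S A * `n x.
Proof.
move=> [_ _ [c cA]]; rewrite /opnorm; set E := (X in inf X).
(* The constant in [bounded_op] may be negative, while [opnorm] ranges over nonnegative bounds. *)
have Emax : E (Num.max c 0).
  split=> [|x Sx]; first by rewrite le_max lexx orbT.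
  by apply: (le_trans (cA _ Sx)); apply: ler_wpM2r => //; rewrite le_max lexx.
have E0 : lbound E 0 by move=> d [].
have Einf : has_inf E by split; [exists (Num.max c 0)|exists 0].
split=> [|x Sx]; first by apply: lb_le_inf => //; case: Einf.
apply/ler_addgt0Pr => e e0.
have n1 : 0 < `n x + 1 by have := n_ge0 x; lra.
have [d [_ dA] dlt] := inf_adherent (divr_gt0 e0 n1) Einf.
apply: (le_trans (dA _ Sx)).
apply: (le_trans (ler_wpM2r (n_ge0 x) (ltW dlt))).
rewrite mulrDl lerD2l -mulrA ler_piMr ?(ltW e0) //.
by rewrite mulrC ler_pdivrMr // mul1r lerDl.
Qed.

Lemma contraction_le (S : set V) (A : V -> V) : bounded_op ip S A ->
  contraction ip S A -> forall x, S x -> `n (A x) <= `n x.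
Proof.
move=> bA cA x Sx; have [_ /(_ _ Sx) h] := opnorm_attained bA.
by apply: (le_trans h); rewrite ler_piMl.
Qed.

(** [Bs] is isometric, so ||B x||^2 = <x, B* B x> <= ||x|| ||B x||. *)
Lemma coisometry_le (B Bs : V -> V) : (forall x y, r (B x) y = r x (Bs y)) ->
  (forall x, B (Bs x) = x) -> forall x, `n (B x) <= `n x.
Proof.
move=> adj BBs x; apply: ipnorm_sqr_le => //.
have BsE y : `n (Bs y) = `n y by rewrite !ipnormE /snorm -adj BBs.
rewrite adj -(BsE (B x)); apply: (le_trans (ler_norm _)).
exact: semiform_cauchy_schwarz rF _ _.
Qed.

(** The power identities need only that [range_of P] is invariant under [T] and [X] and that [W] and
    [Y] agree with them there: both products then stay in [range_of P], where [P] is the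
    identity. *)
Lemma good_extension_of_intertwining (P T W X A B Bs : V -> V) :
  orth_proj ip P -> bounded_op ip (range_of P) T -> bounded_op ip (range_of P) X ->
  extension (range_of P) W T ->
  linear_on setT A -> (forall h, range_of P h -> range_of P (A h)) ->
  (forall x, `n (A x) <= `n x) ->
  linear_on setT B -> linear_on setT Bs ->
  (forall x y, r (B x) y = r x (Bs y)) -> (forall x, B (Bs x) = x) ->
  (forall h, range_of P h -> X (A h) = B (X h)) ->
  good_extension ip P T W X (fun Y => forall x, Y (A x) = B (Y x)).
Proof.
move=> [[_ lP _] PP P_adj] bT bX WT lA NA A_le lB lBs B_adj BBs XA.
set N := range_of P in bT bX WT NA XA *.
have {}lP : linear_on setT P by move=> a x y _ _; exact: lP.
have sN : subspace N.
  split=> [|a x y Nx Ny].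
    by have := linear_onB lP (x := 0) (y := 0) I I; rewrite !subrr.
  by rewrite /N /range_of /= lP // Nx Ny.
have P_le x : `n (P x) <= `n x.
  apply: ipnorm_sqr_le => //.
  rewrite /reip -P_adj PP -/(r _ _) rC.
  exact: le_trans (ler_norm _) (semiform_cauchy_schwarz rF _ _).
have [o0 X_le] := opnorm_attained bX.
have [NT _ _] := bT; have [NX lX _] := bX.
have [Y [lY YX YA Y_le]] := intertwining_extension sN o0 lX X_le lB lBs B_adj BBs
  lP PP (fun h Nh => Nh) P_le lA NA A_le XA.
have iterN (C D : V -> V) m h : (forall k, N k -> N (C k)) ->
    (forall k, N k -> D k = C k) -> N h -> N (iter m C h) /\ iter m D h = iter m C h.
  move=> NC DC Nh; elim: m => [//|m [IH1 IH2]] /=.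
  by rewrite IH2 DC //; split=> //; exact: NC.
have bY : bounded_op ip setT Y.
  by split=> //; exists (opnorm ip N X).
exists Y; split=> //.
- move=> n m h Nh.
  have [NXm ->] := iterN X Y m h NX YX Nh.
  have [NTX ->] := iterN T W n _ NT WT NXm.
  have [NTm ->] := iterN T W m h NT WT Nh.
  have [NXT ->] := iterN X Y n _ NX YX NTm.
  by split.
(* Each of the two norms is an admissible bound for the other operator. *)
- apply/eqP; rewrite eq_le; apply/andP; split.
    apply: ge_inf; first by exists 0 => d [].
    by split=> // x _; exact: Y_le.
  have [oY0 oY] := opnorm_attained bY.
  apply: ge_inf; first by exists 0 => d [].
  by split=> // x Nx; rewrite -YX //; exact: oY.
Qed.

End Lifting.

(** * The three commutation relations *)

Theorem mainTheorem5 (R : realType) (V : lmodType R[i]) (ip : V -> V -> R[i])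
    (P T W X Q Qb : V -> V) :
  hilbert ip ->
  orth_proj ip P ->
  bounded_op ip (range_of P) T -> contraction ip (range_of P) T ->
  coisometric_extension ip (range_of P) W T ->
  bounded_op ip (range_of P) X ->
  bounded_op ip (range_of P) Q -> contraction ip (range_of P) Q ->
  bounded_op ip setT Qb -> contraction ip setT Qb ->
  reduces ip (range_of P) Qb -> extension (range_of P) Qb Q ->
  [/\ (forall h, range_of P h -> X (T (Q h)) = T (X h)) ->
        good_extension ip P T W X (fun Y => forall x, Y (W (Qb x)) = W (Y x)),
      (forall h, range_of P h -> X (Q (T h)) = T (X h)) ->
        good_extension ip P T W X (fun Y => forall x, Y (Qb (W x)) = W (Y x))
    & unitary ip (range_of P) Q -> unitary ip setT Qb ->
      (forall h, range_of P h -> Q (X (T h)) = T (X h)) ->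
        good_extension ip P T W X (fun Y => forall x, Qb (Y (W x)) = W (Y x))].
Proof.
move=> hV oP bT _ [bW WT [Ws [bWs W_adj WWs]]] bX bQ _ bQb cQb _ QbQ.
have [_ lW _] := bW; have [_ lWs _] := bWs; have [_ lQb _] := bQb.
have [NT _ _] := bT; have [NX _ _] := bX; have [NQ _ _] := bQ.
have W_radj x y : reip ip (W x) y = reip ip x (Ws y) by rewrite /reip W_adj.
have W_le := coisometry_le hV W_radj WWs.
have Qb_le x : ipnorm ip (Qb x) <= ipnorm ip x by exact: contraction_le bQb cQb _ _.
split.
- move=> XTQ; apply: (@good_extension_of_intertwining _ _ _ hV _ _ _ _
    (W \o Qb) W Ws) => //=.
  + by move=> a x y _ _ /=; rewrite lQb // lW.
  + by move=> h Nh /=; rewrite QbQ // WT; [apply: NT|]; exact: NQ.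
  + by move=> x; exact: le_trans (W_le _) (Qb_le _).
  + by move=> h Nh; rewrite QbQ // !WT ?XTQ //; [exact: NX|exact: NQ].
- move=> XQT; apply: (@good_extension_of_intertwining _ _ _ hV _ _ _ _
    (Qb \o W) W Ws) => //=.
  + by move=> a x y _ _ /=; rewrite lW // lQb.
  + by move=> h Nh /=; rewrite WT // QbQ; [apply: NQ|]; exact: NT.
  + by move=> x; exact: le_trans (Qb_le _) (W_le _).
  + by move=> h Nh; rewrite WT // QbQ ?WT ?XQT //; [exact: NX|exact: NT].
- move=> _ [Qs [bQs Q_adj QsK]] QXT.
  have [_ lQs _] := bQs.
  (* [Qs] inverts [Qb], so [Qs \o W] is a co-isometry with adjoint [Ws \o Qb]. *)
  have [||||||||Y [bY YX YA YI Yn]] := @good_extension_of_intertwining _ _ _ hV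
    P T W X W (Qs \o W) (Ws \o Qb) oP bT bX WT => //=.
  + by move=> h Nh; rewrite WT //; exact: NT.
  + by move=> a x y _ _ /=; rewrite lW // lQs.
  + by move=> a x y _ _ /=; rewrite lQb // lWs.
  + move=> x y; have [_ rC _ _ _] := reip_semiform hV.
    by rewrite -W_radj rC [RHS]rC /reip Q_adj.
  + by move=> x; rewrite WWs (QsK x I).1.
  + move=> h Nh; rewrite !WT //; last exact: NX.
    (* On [range_of P] the relation reads T X = Qb X T; applying [Qs] cancels [Qb]. *)
    rewrite -QXT // -QbQ; last by apply/NX/NT.
    by rewrite (QsK _ I).1.
  + by exists Y; split=> // x; rewrite YA /= (QsK _ I).2.
Qed.
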